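(* Let $n,k$ be positive integers, let $\lambda,\mu,\nu\in\Pi^{(n,k)}$, and suppose that $\mu$ is a one-column or two-column partition (i.e. $\mu_1\in\{1,2\}$). Then $$N_{\lambda\mu}^{(k)\nu}\le N_{\lambda\mu}^{(k+1)\nu}.$$
   Context: A partition $\lambda$ is $(n,k)$-restricted if it has at most $n$ nonzero parts and $0\le\lambda_1-\lambda_n\le k$ (with missing parts equal to $0$); $\Pi^{(n,k)}$ is the set of these partitions, so $\Pi^{(n,k)}\subset\Pi^{(n,k+1)}$. Let $J^{(n,k)}$ be the ideal of $\mathbb Q[x_1,\dots,x_n]^{S_n}$ generated by the Schur polynomials $s_\lambda$ for partitions $\lambda$ with at most $n$ parts and $\lambda_1-\lambda_n=k+1$. The images of $s_\lambda$, $\lambda\in\Pi^{(n,k)}$, form a linear basis of $\mathbb Q[x_1,\dots,x_n]^{S_n}/J^{(n,k)}$. The $sl(n)$ fusion coefficients at level $k$ are defined, for $\lambda,\mu\in\Pi^{(n,k)}$, by $s_\lambda s_\mu=\sum_{\nu\in\Pi^{(n,k)}}N_{\lambda\mu}^{(k)\nu}s_\nu$ in this quotient. (Imposing also $s_{(1^n)}=1$ gives the fusion algebra of $\widehat{sl(n)}$ at level $k$.) The integer $n$ is fixed throughout. *)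

(* Defs.v *)
From HB Require Import structures.
From mathcomp Require Import all_boot all_order all_fingroup all_algebra.
From mathcomp Require Import finmap mpoly.
From Stdlib Require Import ClassicalEpsilon.

Set Implicit Arguments.
Unset Strict Implicit.
Unset Printing Implicit Defensive.

Import GRing.Theory.
Local Open Scope ring_scope.

(* A partition with at most n nonzero parts is encoded as the weakly decreasing
   n-tuple of its parts, padded with zeros; its (i+1)-st part is nth 0 la i. *)
Section Partitions.
Variable n : nat.
Implicit Types (la : n.-tuple nat) (k : nat).

Definition is_partition : pred (n.-tuple nat) := fun la => sorted geq la.

(* la_1 - la_n; on partitions the truncated subtraction is the true one. *)
Definition width la : nat := (nth 0%N la 0 - nth 0%N la n.-1)%N.

Definition restricted k : pred (n.-tuple nat) :=
  [pred la | is_partition la & (width la <= k)%N].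

End Partitions.

(* X^m is reduced modulo \prod_j (X - x_j), whose roots are the x_i. *)
Lemma expr_reduce (R : comNzRingType) (n : nat) (x : 'I_n -> R) :
  exists r : nat -> nat -> R,
    forall m i, x i ^+ m = \sum_(l < n) r m l * x i ^+ l.
Proof.
pose p : {poly R} := \prod_(j < n) ('X - (x j)%:P).
have p_monic : p \is monic by apply: monic_prod_XsubC.
have size_p : size p = n.+1.
  by rewrite size_prod_XsubC /index_enum -enumT size_enum_ord.
have p_root i : p.[x i] = 0.
  by rewrite horner_prod (bigD1 i) //= hornerXsubC subrr mul0r.
pose r (m : nat) := Pdiv.CommonRing.rmodp ('X^m) p.
have size_r m : (size (r m) <= n)%N.
  by rewrite -ltnS -size_p Pdiv.CommonRing.ltn_rmodpN0 ?monic_neq0.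
exists (fun m l => (r m)`_l) => m i.
rewrite -(horner_coef_wide _ (size_r m)) -[LHS]hornerXn.
rewrite [in LHS](Pdiv.RingMonic.rdivp_eq p_monic 'X^m).
by rewrite hornerD hornerM p_root mulr0 add0r.
Qed.

Section Schur.
Variable n : nat.

Definition alternant (a : 'I_n -> nat) : {mpoly rat[n]} :=
  \det (\matrix_(i < n, j < n) ('X_i ^+ a j : {mpoly rat[n]})).

Definition staircase (j : 'I_n) : nat := (n.-1 - j)%N.

Lemma alternant_dvd (a : 'I_n -> nat) :
  exists s, s * alternant staircase == alternant a.
Proof.
have [r eval_r] := expr_reduce (fun i : 'I_n => 'X_i : {mpoly rat[n]}).
exists (\det (\matrix_(l < n, j < n) r (a j) (n.-1 - l)%N)).
rewrite mulrC -det_mulmx; apply/eqP; congr (\det _).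
apply/matrixP => i j; rewrite !mxE eval_r (reindex_inj rev_ord_inj) /=.
apply: eq_bigr => l _.
rewrite !mxE mulrC /staircase -subn1 -subnDA add1n.
by have -> : (n - (rev_ord l).+1 = l)%N := congr1 val (rev_ordK l).
Qed.

Lemma alternant_staircase_neq0 : alternant staircase != 0.
Proof.
pose V := Vandermonde n (\row_(i < n) ('X_i : {mpoly rat[n]})).
have -> : alternant staircase = \det (row_perm (perm rev_ord_inj) V).
  rewrite -det_tr; congr (\det _); apply/matrixP => i j.
  by rewrite !mxE permE /staircase /= -subn1 -subnDA add1n.
rewrite row_permE det_mulmx det_perm mulf_neq0 ?signr_eq0 //.
rewrite det_Vandermonde prodf_seq_neq0; apply/allP => i _ /=.
rewrite prodf_seq_neq0; apply/allP => j _ /=; apply/implyP => lt_ij.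
rewrite !mxE subr_eq0; apply/eqP => eqX.
have := congr1 (mcoeff U_(j)%MM) eqX; rewrite !mcoeffX eqxx.
case: eqP => [/mnmP /(_ i)|_ /eqP]; last by rewrite oner_eq0.
by rewrite !mnm1E eqxx; case: eqP lt_ij => // ->; rewrite ltnn.
Qed.

(* The Schur polynomial: the bialternant quotient a_(la + delta) / a_delta. *)
Definition schur (la : n.-tuple nat) : {mpoly rat[n]} :=
  xchoose (alternant_dvd (fun j => (tnth la j + staircase j)%N)).

Lemma schurE la :
  schur la * alternant staircase
    = alternant (fun j => (tnth la j + staircase j)%N).
Proof. exact/eqP/(xchooseP (alternant_dvd _)). Qed.

Lemma schur_unique la s :
  s * alternant staircase = alternant (fun j => (tnth la j + staircase j)%N) ->
  s = schur la.
Proof. by rewrite -schurE => /(mulIf alternant_staircase_neq0). Qed.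

End Schur.

Section Fusion.
Variables n k : nat.

(* The ideal J^(n,k) of the ring of symmetric polynomials: the coefficients of
   the finite combinations are themselves symmetric. *)
Definition fusion_ideal (p : {mpoly rat[n]}) : Prop :=
  exists s : seq ({mpoly rat[n]} * n.-tuple nat),
    all [pred fl | [&& fl.1 \is symmetric, is_partition fl.2
                     & width fl.2 == k.+1]] s
    /\ p = \sum_(fl <- s) fl.1 * schur fl.2.

(* c is a finitely supported family (c_nu), nu in Pi^(n,k), such that
   s_la * s_mu = \sum_nu c_nu s_nu modulo J^(n,k). *)
Definition is_fusion_expansion (la mu : n.-tuple nat)
    (c : {fsfun n.-tuple nat -> rat with 0}) : Prop :=
  {subset finsupp c <= restricted k} /\
  fusion_ideal (schur la * schur mu - \sum_(nu <- finsupp c) c nu *: schur nu).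

Definition fusion_expansion (la mu : n.-tuple nat) :
    {fsfun n.-tuple nat -> rat with 0} :=
  epsilon (inhabits [fsfun]) (is_fusion_expansion la mu).

(* The coefficient N of s_nu. Since the classes of the s_nu, nu in Pi^(n,k),
   form a basis of the quotient, epsilon selects the only expansion. *)
Definition fusion_coef (la mu nu : n.-tuple nat) : rat :=
  fusion_expansion la mu nu.

End Fusion.

Arguments fusion_coef {n} k la mu nu.

(* Main.v *)
From HB Require Import structures.
Require Import Defs.
From mathcomp Require Import all_boot all_order all_algebra.
From mathcomp Require Import all_fingroup finmap mpoly zify.
From Stdlib Require Import ClassicalEpsilon.

Set Implicit Arguments.
Unset Strict Implicit.
Unset Printing Implicit Defensive.

Import Order.TTheory GRing.Theory Num.Theory.
Local Open Scope ring_scope.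

(** Write $h = n + k$ and $\rho = (n-1, \dots, 0)$, and let the affine group
    generated by $S_n$ and the translations by $h (e_i - e_j)$ act on
    exponents.

    The fusion coefficients are isolated by linear functionals. For an
    exponent $b$ with trivial stabilizer, send $x^m$ to the sign of the affine
    element carrying $b$ to $m$, and to $0$ when there is none. This
    functional changes sign under every affine reflection. If $f$ is symmetric
    and $a$ lies on a reflecting hyperplane, reflecting the terms of $f x^a$
    permutes them, so the functional kills $f x^a$ ([affine_coef_wall]). A
    generator $s_\lambda$ of $J^{(n,k)}$ has $\lambda + \rho$ on such a
    hyperplane; the functional with $b = \nu + \rho$, applied to $f a_\rho$,
    therefore descends to the quotient, and it is dual to the Schur
    polynomials because restricted partitions shifted by $\rho$ lie in one
    alcove, a fundamental domain ([fusion_coord_ideal], [fusion_coord_schur]).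

    For $\mu = (2^q, 1^{p-q})$ one has $s_\mu = e_p e_q - e_{p+1} e_{q-1}$
    ([schur_columns]), so that two uses of the Pieri rule suffice. Adding a
    vertical strip raises the width by at most one, hence modulo $J^{(n,k)}$
    the product $e_r s_\lambda$ is the sum of the $s_\kappa$ with $\kappa /
    \lambda$ a vertical $r$-strip and $\kappa$ restricted ([fusion_pieri]).
    This also gives the existence of an expansion of $s_\lambda s_\mu$.
    Consequently $N^{(k)\nu}_{\lambda\mu} = A^k_{p,q} - A^k_{p+1,q-1}$, where
    $A^k_{p,q}$ counts the chains $\lambda \subset \kappa \subset \nu$ of two
    vertical strips of sizes $p$ and $q$ with $\kappa$ of width at most $k$
    ([fusion_coef_columns]); the second term is absent when $q = 0$.

    Passing from $k$ to $k + 1$ adds to $A_{p,q}$ the number $B_{p,q}$ of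
    chains whose middle term has width exactly $k + 1$, so the claim is
    $B_{p+1,q-1} \le B_{p,q}$ ([card_wall_pairs]). Read the pair $(S, T)$ of
    row sets of the two strips as a lattice path with an up step at each row
    of $S$ and a down step at each row of $T$. For the pairs counted by
    $B_{p+1,q-1}$ the path ends at height at least $2$. Move to $T$ the row of
    $S$ whose up step first reaches the maximum. As in the Greene-Kleitman
    matching of parentheses, the step is recovered from the new path as the
    one that follows the last maximum, so the map is injective; at a first
    maximum, row $i$ is never forced to stay in $S$ by row $i + 1$, so the
    middle term stays a partition; and neither the first nor the last row
    moves, so its width does not change. *)

(** * Antisymmetrization and alternants *)

Section Antisymmetrization.
Variable n : nat.
Implicit Types (m a : 'X_{1..n}) (f g p : {mpoly rat[n]}) (s : 'S_n).

Local Notation "m # s" := [multinom m (s i) | i < n]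
  (at level 40, left associativity).

Definition antisymmetrize p : {mpoly rat[n]} :=
  \sum_(s : 'S_n) (-1) ^+ s *: msym s p.

Fact antisymmetrize_is_linear : linear antisymmetrize.
Proof.
move=> c p g; rewrite /antisymmetrize scaler_sumr -big_split /=.
apply: eq_bigr => s _; rewrite linearP scalerDr !scalerA.
by rewrite [c * _]mulrC.
Qed.

HB.instance Definition _ :=
  GRing.isLinear.Build rat {mpoly rat[n]} {mpoly rat[n]} _ antisymmetrize
    antisymmetrize_is_linear.

(** This is what makes multiplication of alternants by symmetric polynomials a
    computation with single monomials. *)
Lemma antisymmetrizeM f g :
  f \is symmetric -> f * antisymmetrize g = antisymmetrize (f * g).
Proof.
move=> /issymP f_sym; rewrite /antisymmetrize mulr_sumr.
by apply: eq_bigr => s _; rewrite msymM f_sym scalerAr.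
Qed.

Lemma eq_alternant (a b : 'I_n -> nat) : a =1 b -> alternant a = alternant b.
Proof.
move=> eq_ab; congr (\det _); apply/matrixP => i j.
by rewrite !mxE eq_ab.
Qed.

Lemma alternantE a : alternant a = antisymmetrize 'X_[a].
Proof.
rewrite /alternant /determinant /antisymmetrize [RHS](reindex_inj invg_inj) /=.
apply: eq_bigr => s _; rewrite msymX invgK odd_permV.
rewrite -mul_mpolyC rmorphXn rmorphN1.
congr (_ * _); rewrite mpolyXE_id.
by apply: eq_bigr => i _; rewrite mxE mnmE.
Qed.

Lemma alternant_eq0 a i j : i != j -> a i = a j -> alternant a = 0.
Proof.
move=> neq_ij eq_a; rewrite /alternant -det_tr.
by apply: (determinant_alternate neq_ij) => l; rewrite !mxE eq_a.
Qed.

Lemma mulr_alternant f a :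
  f \is symmetric -> f * alternant a = antisymmetrize (f * 'X_[a]).
Proof. by move=> f_sym; rewrite alternantE antisymmetrizeM. Qed.

Lemma mulr_alternant_sum (I : finType) (P : pred I) (v : I -> 'X_{1..n}) f a :
    f = \sum_(i | P i) 'X_[v i] -> f \is symmetric ->
  f * alternant a = \sum_(i | P i) alternant (a + v i)%MM.
Proof.
move=> def_f f_sym; rewrite mulr_alternant // {1}def_f mulr_suml raddf_sum /=.
by apply: eq_bigr => i _; rewrite alternantE addmC mpolyXD.
Qed.

End Antisymmetrization.

(** * A functional that is antisymmetric under the affine group *)

Section AffineWeight.
Variable n : nat.
Implicit Types (m a b : 'X_{1..n}) (f g p : {mpoly rat[n]}) (s : 'S_n).

Local Notation "m # s" := [multinom m (s i) | i < n]
  (at level 40, left associativity).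

(** When the entries of $b$ are distinct modulo $h$, the determinant is the sign
    of the permutation matching $m$ and $b$ modulo $h$, if any. Permutations
    and translations by $h \mathbb Z^n$ generate too large a group; the
    condition on degrees leaves the translations of sum zero, which together
    with the permutations form the affine group. *)
Definition affine_sign h b m : rat :=
  if mdeg m == mdeg b
  then \det (\matrix_(i < n, j < n) (m i == b j %[mod h])%:R) else 0.

Lemma affine_sign_perm h b m s :
  affine_sign h b (m # s) = (-1) ^+ s * affine_sign h b m.
Proof.
rewrite /affine_sign mdeg_mperm; case: ifP => _; last by rewrite mulr0.
rewrite -det_perm -det_mulmx -row_permE; congr (\det _).
by apply/matrixP => i j; rewrite !mxE mnmE.
Qed.

Lemma affine_sign_mod h b m m' :
    mdeg m = mdeg m' -> (forall i, m i = m' i %[mod h]) ->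
  affine_sign h b m = affine_sign h b m'.
Proof.
move=> eq_deg eq_mod; rewrite /affine_sign eq_deg; case: ifP => // _.
by congr (\det _); apply/matrixP => i j; rewrite !mxE eq_mod.
Qed.

(** Only monomials of the degree of $b$ matter, and truncating at that degree
    makes the sum one over a fixed finite type, hence visibly linear. *)
Definition affine_coef h b p : rat :=
  \sum_(m : 'X_{1..n < (mdeg b).+1}) p@_m * affine_sign h b m.

Fact affine_coef_is_linear h b : scalar (affine_coef h b).
Proof.
move=> c p q; rewrite /affine_coef mulr_sumr -big_split /=.
by apply: eq_bigr => m _; rewrite mcoeffD mcoeffZ mulrDl mulrA.
Qed.

HB.instance Definition _ h b :=
  GRing.isLinear.Build rat {mpoly rat[n]} rat _ (affine_coef h b)
    (affine_coef_is_linear h b).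

Lemma affine_coefZ h b c p : affine_coef h b (c *: p) = c * affine_coef h b p.
Proof. exact: scalarZ. Qed.

Lemma affine_coefX h b m : affine_coef h b 'X_[m] = affine_sign h b m.
Proof.
rewrite /affine_coef; have [lt_m | ge_m] := ltnP (mdeg m) (mdeg b).+1.
  rewrite (bigD1 (BMultinom lt_m)) //= mcoeffX eqxx mul1r big1 ?addr0 // => m'.
  rewrite mcoeffX -val_eqE /= eq_sym; case: eqP => // _ _.
  by rewrite mul0r.
rewrite big1 => [|m' _].
  by rewrite /affine_sign; case: eqP => // eq_m; rewrite eq_m ltnn in ge_m.
rewrite mcoeffX; case: eqP => [def_m|_]; last by rewrite mul0r.
by have := bmdeg m'; rewrite -def_m ltnNge ge_m.
Qed.

Lemma affine_coef_expand h b p a :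
  affine_coef h b (p * 'X_[a])
    = \sum_(m <- msupp p) p@_m * affine_sign h b (m + a)%MM.
Proof.
rewrite {1}(mpolyE p) mulr_suml raddf_sum /=; apply: eq_bigr => m _.
by rewrite -scalerAl -mpolyXD affine_coefZ affine_coefX.
Qed.

Lemma msym_expand s p :
  msym s p = \sum_(m <- msupp p) p@_m *: 'X_[m # (s^-1)%g].
Proof.
rewrite {1}(mpolyE p) (raddf_sum (msym s)); apply: eq_bigr => m _.
by rewrite -[LHS]/(msym s _) msymZ msymX.
Qed.

Lemma affine_coef_msym h b s p :
  affine_coef h b (msym s p) = (-1) ^+ s * affine_coef h b p.
Proof.
rewrite msym_expand [in RHS](mpolyE p) !(raddf_sum (affine_coef h b)) mulr_sumr.
apply: eq_bigr => m _ /=; rewrite !affine_coefZ !affine_coefX affine_sign_perm.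
by rewrite odd_permV mulrCA.
Qed.

Lemma affine_coef_antisymmetrize h b p :
  affine_coef h b (antisymmetrize p) = n`!%:R * affine_coef h b p.
Proof.
rewrite /antisymmetrize raddf_sum /=.
rewrite (eq_bigr (fun _ => affine_coef h b p)) => [|s _].
  by rewrite sumr_const card_Sn mulr_natl.
by rewrite affine_coefZ affine_coef_msym mulrA -expr2 sqrr_sign mul1r.
Qed.

Lemma affine_coef_alternant h b f a :
    f \is symmetric ->
  affine_coef h b (f * alternant a) = n`!%:R * affine_coef h b (f * 'X_[a]).
Proof.
by move=> f_sym; rewrite mulr_alternant // affine_coef_antisymmetrize.
Qed.

(** The reflection in the hyperplane $a_i \equiv a_j$ fixes $a$ up to a
    translation and permutes the terms of the symmetric $f$, while it changes
    the sign of the functional: the value equals its own opposite. *)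
Lemma affine_coef_wall h b f a i j :
    f \is symmetric -> i != j -> a i = a j %[mod h] ->
  affine_coef h b (f * 'X_[a]) = 0.
Proof.
move=> /issymP f_sym neq_ij eq_a; pose s := tperm i j.
have asym: affine_coef h b (f * 'X_[a]) = - affine_coef h b (f * 'X_[a]).
  rewrite -{1}(f_sym s) msym_expand mulr_suml raddf_sum /=.
  rewrite affine_coef_expand -sumrN; apply: eq_bigr => m _.
  rewrite -scalerAl -mpolyXD affine_coefZ affine_coefX -mulrN.
  congr (_ * _); rewrite tpermV.
  transitivity (affine_sign h b ((m + a)%MM # s)).
    apply: affine_sign_mod => [|l].
      by rewrite mdeg_mperm !mdegD mdeg_mperm.
    rewrite !mnmDE !mnmE -modnDmr -[RHS]modnDmr /s.
    by case: tpermP => [->|->|_ _] //; rewrite eq_a.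
  by rewrite affine_sign_perm odd_tperm neq_ij expr1 mulN1r.
by apply/eqP; rewrite -eqNr -asym.
Qed.

End AffineWeight.

(** * The fundamental alcove *)

Section Alcove.
Variables (n h : nat).
Implicit Types (a b : 'X_{1..n}).

Definition alcove a :=
  (forall i j : 'I_n, (i < j)%N -> (a j < a i)%N)
  /\ (forall i j : 'I_n, (a i < a j + h)%N).

Lemma alcove_inj a : alcove a -> injective a.
Proof.
case=> decr _ i j eq_a; case: (ltngtP i j) => [lt_ij|lt_ji|/val_inj //].
  by have := decr _ _ lt_ij; rewrite eq_a ltnn.
by have := decr _ _ lt_ji; rewrite eq_a ltnn.
Qed.

Lemma alcove_eq_image a b :
  alcove a -> alcove b -> (forall i, exists j, a i = b j) -> a = b.
Proof.
move=> a_alc b_alc sub_ab.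
have sorted_val c : alcove c -> sorted gtn (c : seq nat).
  case=> decr _; apply/(sortedP 0%N) => i; rewrite size_tuple => lt_i.
  have := decr (Ordinal (ltnW lt_i)) (Ordinal lt_i) (ltnSn i).
  by rewrite !(mnm_nth 0%N).
have irr : irreflexive gtn by move=> i; rewrite /= ltnn.
have tr : transitive gtn by move=> i j l /= lt_ij lt_li; apply: ltn_trans lt_ij.
have uniq_val c : alcove c -> uniq (c : seq nat).
  by move/sorted_val; apply: sorted_uniq.
do 2!apply/val_inj; apply: (irr_sorted_eq tr irr) => //; try exact: sorted_val.
apply: (uniq_min_size (uniq_val _ a_alc) _ _).2 => [x|]; last first.
  by rewrite !size_tuple.
case/tnthP=> i ->; have [j def_a] := sub_ab i.
by rewrite -mnm_tnth def_a mnm_tnth mem_tnth.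
Qed.

(** The alcove meets each orbit once. By symmetry the smallest entry of $b$ is
    at most that of $a$; then $a_i > b_{s(i)} - h$ for all $i$, so the
    congruences give $a_i \ge b_{s(i)}$, and equality of the degrees forces
    equality throughout. *)
Lemma alcove_orbit a b (s : 'S_n) :
    alcove a -> alcove b -> mdeg a = mdeg b ->
    (forall i, a i = b (s i) %[mod h]) ->
  a = b.
Proof.
move=> a_alc b_alc.
wlog le_ba: a b s a_alc b_alc / forall i j, (b j < a i + h)%N.
  move=> IH eq_deg eq_ab; case: (posnP n) => [n0|n_gt0].
    by apply/mnmP => i; have := ltn_ord i; rewrite {2}n0.
  pose l := Ordinal (etrans (congr1 (leq^~ n) (prednK n_gt0)) (leqnn n)).
  have minl c i : alcove c -> (c l <= c i)%N.
    case=> decr _; case: (ltngtP i l) => [/decr/ltnW //| |/val_inj -> //].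
    by rewrite ltnNge -ltnS (ltn_predK n_gt0) ltn_ord.
  have [le_l|/ltnW le_l] := leqP (b l) (a l).
    apply: (IH a b s) => // i j; apply: leq_trans (b_alc.2 j l) _.
    by rewrite leq_add2r (leq_trans le_l) ?minl.
  apply/esym/(IH b a (s^-1)%g) => // [i j|i].
    apply: leq_trans (a_alc.2 j l) _.
    by rewrite leq_add2r (leq_trans le_l) ?minl.
  by rewrite eq_ab permKV.
move=> eq_deg eq_ab.
have le_b i : (b (s i) <= a i)%N.
  rewrite leqNgt; apply/negP => lt_ab.
  have := le_ba i (s i); have := eq_ab i.
  rewrite -(subnKC (ltnW lt_ab)) -[a i in LHS]addn0 => /eqP.
  rewrite eqn_modDl mod0n eq_sym => /eqP mod0; rewrite ltn_add2l => lt_h.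
  by move: mod0; rewrite modn_small // => /eqP; rewrite subn_eq0 leqNgt lt_ab.
apply: alcove_eq_image => // i; exists (s i); apply/eqP; rewrite eq_sym.
have [_ eq_sum] := leqif_sum (fun (j : 'I_n) (_ : true) => leqif_eq (le_b j)).
have sum_b : (\sum_j b (s j) = mdeg b)%N.
  by rewrite mdegE [RHS](reindex_inj (@perm_inj _ s)).
by move: eq_sum; rewrite sum_b -mdegE eq_deg eqxx => /esym/forallP/(_ i).
Qed.

Lemma alcove_mod_inj a (i j : 'I_n) :
  alcove a -> a i = a j %[mod h] -> i = j.
Proof.
move=> a_alc; wlog le_ij: i j / (a i <= a j)%N.
  move=> IH eq_a; have [/IH|/ltnW/IH] := leqP (a i) (a j); first exact.
  by move=> /(_ (esym eq_a)).
move=> eq_a; apply: (alcove_inj a_alc).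
have lt_h := a_alc.2 j i; move/eqP: eq_a; rewrite -(subnKC le_ij).
rewrite -{1}[a i]addn0 eqn_modDl mod0n modn_small; last by lia.
by move=> /eqP <-; rewrite addn0.
Qed.

Lemma affine_sign_alcove a b :
  alcove a -> alcove b -> affine_sign h b a = (a == b)%:R.
Proof.
move=> a_alc b_alc; case: eqP => [<-|neq_ab].
  rewrite /affine_sign eqxx (_ : \matrix_(i, j) _ = 1%:M) ?det1 //.
  apply/matrixP => i j; rewrite !mxE; congr (nat_of_bool _)%:R.
  apply/eqP/eqP => [|->] //; exact: alcove_mod_inj.
rewrite /affine_sign; case: eqP => // eq_deg.
rewrite /determinant big1 // => s _.
case: (pickP (fun i => a i != b (s i) %[mod h])) => [i neq_i|eq_s].
  by rewrite (bigD1 i) //= mxE (negPf neq_i) mul0r mulr0.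
case: neq_ab; apply: (alcove_orbit a_alc b_alc eq_deg (s := s)) => i.
by apply/eqP; rewrite -[_ == _]negbK eq_s.
Qed.

End Alcove.

(** * Partitions shifted into the alcove *)

Section SchurExponents.
Variable n : nat.
Implicit Types (la mu nu : n.-tuple nat).

Definition rho : 'X_{1..n} := [multinom staircase i | i < n].

Definition shifted la : 'X_{1..n} :=
  [multinom (tnth la i + staircase i)%N | i < n].

Lemma schur_alternant la :
  schur la * alternant rho = alternant (shifted la).
Proof.
rewrite (@eq_alternant n rho (@staircase n)); last by move=> i; rewrite mnmE.
by rewrite schurE; apply: eq_alternant => i; rewrite mnmE.
Qed.

Lemma alternant_rho_neq0 : alternant rho != 0.
Proof.
rewrite (@eq_alternant n rho (@staircase n)); last by move=> i; rewrite mnmE.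
exact: alternant_staircase_neq0.
Qed.

Lemma partition_nth la i j :
  is_partition la -> (i <= j)%N -> (nth 0 la j <= nth 0 la i)%N.
Proof.
move=> la_part le_ij; have [lt_j|ge_j] := ltnP j n; last first.
  by rewrite nth_default ?size_tuple.
have tr : transitive geq by move=> x y z /= le_xy le_zx; apply: leq_trans le_xy.
have rfl : reflexive geq by move=> x /=.
apply: (sorted_leq_nth tr rfl 0%N la_part) => //; rewrite inE size_tuple //.
exact: leq_ltn_trans lt_j.
Qed.

Lemma shiftedE la (i : 'I_n) : shifted la i = (nth 0%N la i + (n.-1 - i))%N.
Proof. by rewrite mnmE (tnth_nth 0%N). Qed.

Lemma restricted_alcove k la :
  la \in restricted k -> alcove (n + k) (shifted la).
Proof.
rewrite inE /width => /andP[la_part le_k].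
split=> i j => [lt_ij|]; rewrite !shiftedE.
  have := partition_nth la_part (ltnW lt_ij); have := ltn_ord j; lia.
have := partition_nth la_part (leq0n i); have := ltn_ord j; have := ltn_ord i.
have: (j <= n.-1)%N by have := ltn_ord j; lia.
move=> /(partition_nth la_part); lia.
Qed.

(** Since $\rho_1 - \rho_n = n - 1$, width $k + 1$ makes the extreme entries
    of the shifted partition differ by exactly $n + k$. *)
Lemma width_wall k la :
    (0 < n)%N -> is_partition la -> width la = k.+1 ->
  exists i j : 'I_n, i != j /\ shifted la i = shifted la j %[mod n + k].
Proof.
move=> n_gt0 la_part; rewrite /width => width_la.
have lt_n : (n.-1 < n)%N by rewrite prednK.
exists (Ordinal n_gt0), (Ordinal lt_n); split.
  by apply/eqP => -[eq0]; move: width_la; rewrite -eq0 subnn.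
rewrite !shiftedE /= (_ : _ + _ = nth 0%N la n.-1 + (n.-1 - n.-1) + (n + k))%N.
  by rewrite modnDr.
by have := partition_nth la_part (leq0n n.-1); lia.
Qed.

Lemma shifted_inj : injective shifted.
Proof.
move=> la mu /mnmP eq_sh; apply: eq_from_tnth => i.
by have := eq_sh i; rewrite !mnmE => /addIn.
Qed.

End SchurExponents.

(** * Coordinates on the quotient *)

Section FusionCoordinates.
Variables n k : nat.
Hypothesis n_gt0 : (0 < n)%N.
Implicit Types (la mu nu : n.-tuple nat) (p : {mpoly rat[n]}).

(** The factor $1 / n!$ compensates for the $n!$ equal contributions of the
    terms of an alternant. *)
Definition fusion_coord nu p : rat :=
  n`!%:R^-1 * affine_coef (n + k) (shifted nu) (p * alternant (rho n)).

Fact fusion_coord_is_linear nu : scalar (fusion_coord nu).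
Proof.
move=> c p q; rewrite /fusion_coord mulrDl -scalerAl raddfD /= affine_coefZ.
by rewrite mulrDr mulrCA.
Qed.

HB.instance Definition _ nu :=
  GRing.isLinear.Build rat {mpoly rat[n]} rat _ (fusion_coord nu)
    (fusion_coord_is_linear nu).

Lemma fusion_coordZ nu c p : fusion_coord nu (c *: p) = c * fusion_coord nu p.
Proof. exact: scalarZ. Qed.

Lemma fusion_coord_ideal nu p : fusion_ideal k p -> fusion_coord nu p = 0.
Proof.
case=> s [/allP s_gen ->]; rewrite raddf_sum /= big_seq big1 // => fl.
move=> /s_gen /and3P[f_sym fl_part /eqP fl_width].
rewrite /fusion_coord -mulrA schur_alternant affine_coef_alternant //.
have [i [j [neq_ij eq_ij]]] := width_wall n_gt0 fl_part fl_width.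
by rewrite (affine_coef_wall _ f_sym neq_ij eq_ij) !mulr0.
Qed.

Lemma fusion_coord_schur la nu :
    la \in restricted k -> nu \in restricted k ->
  fusion_coord nu (schur la) = (la == nu)%:R.
Proof.
move=> la_res nu_res.
have fact_neq0 : n`!%:R != 0 :> rat by rewrite pnatr_eq0 -lt0n fact_gt0.
rewrite /fusion_coord schur_alternant -[alternant _]mul1r.
rewrite affine_coef_alternant ?rpred1 // mul1r affine_coefX mulKf //.
rewrite affine_sign_alcove; try exact: restricted_alcove.
by rewrite (inj_eq (@shifted_inj n)).
Qed.

(** Duality makes the expansion unique, so it does not matter which one the
    choice operator returns. *)
Lemma fusion_expansion_coord la mu nu c :
    is_fusion_expansion k la mu c -> nu \in restricted k ->
  c nu = fusion_coord nu (schur la * schur mu).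
Proof.
move=> [c_supp /(fusion_coord_ideal nu) /eqP]; rewrite raddfB subr_eq0 /=.
move=> /eqP -> nu_res; rewrite raddf_sum /= big_seq.
have coordE ka : ka \in finsupp c ->
    fusion_coord nu (c ka *: schur ka) = c ka * (ka == nu)%:R.
  by move=> /c_supp ka_res; rewrite fusion_coordZ fusion_coord_schur.
rewrite (eq_bigr _ coordE).
rewrite -big_seq; have [nu_supp|nu_supp] := boolP (nu \in finsupp c).
  rewrite (big_fsetD1 nu) //= eqxx mulr1 big1_fset ?addr0 // => ka.
  by rewrite in_fsetD1 => /andP[/negPf-> _] _; rewrite mulr0.
rewrite fsfun_dflt // big1_fset // => ka ka_supp _.
by case: eqP ka_supp nu_supp => [-> -> //|]; rewrite mulr0.
Qed.

(** The polynomials that have an expansion. Finite sequences of terms, with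
    repetitions allowed, are easier to add and multiply than finitely supported
    functions; [fusion_coef_coord] collects the terms. *)
Definition restricted_span p : Prop :=
  exists s : seq (rat * n.-tuple nat),
    all (fun x => x.2 \in restricted k) s
    /\ fusion_ideal k (p - \sum_(x <- s) x.1 *: schur x.2).

Lemma fusion_idealD p q :
  fusion_ideal k p -> fusion_ideal k q -> fusion_ideal k (p + q).
Proof.
move=> [s [s_gen ->]] [t [t_gen ->]]; exists (s ++ t).
by rewrite all_cat s_gen t_gen big_cat.
Qed.

Lemma fusion_idealM f p :
  f \is symmetric -> fusion_ideal k p -> fusion_ideal k (f * p).
Proof.
move=> f_sym [s [/allP s_gen ->]]; exists [seq (f * fl.1, fl.2) | fl <- s].
rewrite big_map mulr_sumr; split; last by apply: eq_bigr => fl _; rewrite mulrA.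
apply/allP => _ /mapP[fl /s_gen /and3P[fl_sym fl_part fl_width] ->] /=.
by rewrite rpredM // fl_part.
Qed.

Lemma fusion_idealZ c p : fusion_ideal k p -> fusion_ideal k (c *: p).
Proof.
move=> p_ideal; rewrite -[p]mul1r scalerAl.
by apply: fusion_idealM => //; rewrite rpredZ ?rpred1.
Qed.

Lemma fusion_ideal_schur la :
  is_partition la -> width la = k.+1 -> fusion_ideal k (schur la).
Proof.
move=> la_part la_width; exists [:: (1, la)].
by rewrite /= rpred1 la_part la_width eqxx big_seq1 mul1r.
Qed.

Lemma fusion_ideal0 : fusion_ideal k (0 : {mpoly rat[n]}).
Proof. by exists [::]; rewrite big_nil. Qed.

Lemma restricted_span_ideal p : fusion_ideal k p -> restricted_span p.
Proof. by exists [::]; rewrite big_nil subr0. Qed.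

Lemma restricted_span_schur la :
  la \in restricted k -> restricted_span (schur la).
Proof.
move=> la_res; exists [:: (1, la)]; rewrite /= la_res big_seq1 scale1r subrr.
by split=> //; apply: fusion_ideal0.
Qed.

Lemma restricted_spanD p q :
  restricted_span p -> restricted_span q -> restricted_span (p + q).
Proof.
move=> [s [s_res s_ideal]] [t [t_res t_ideal]]; exists (s ++ t).
rewrite all_cat s_res t_res big_cat; split=> //.
by rewrite opprD addrACA; apply: fusion_idealD.
Qed.

Lemma restricted_spanZ c p : restricted_span p -> restricted_span (c *: p).
Proof.
move=> [s [/allP s_res s_ideal]]; exists [seq (c * x.1, x.2) | x <- s].
split; first by apply/allP => _ /mapP[x /s_res x_res ->].
rewrite big_map (eq_bigr (fun x => c *: (x.1 *: schur x.2))) => [|x _].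
  by rewrite -scaler_sumr -scalerBr; apply: fusion_idealZ.
by rewrite scalerA.
Qed.

Lemma restricted_span_sum (I : Type) (r : seq I) (P : pred I) F :
    (forall i, P i -> restricted_span (F i)) ->
  restricted_span (\sum_(i <- r | P i) F i).
Proof.
move=> F_span; apply: big_ind => //; last exact: restricted_spanD.
exact/restricted_span_ideal/fusion_ideal0.
Qed.

Lemma fusion_coef_coord la mu nu :
    restricted_span (schur la * schur mu) -> nu \in restricted k ->
  fusion_coef k la mu nu = fusion_coord nu (schur la * schur mu).
Proof.
move=> [s [/allP s_res s_ideal]] nu_res.
apply: fusion_expansion_coord nu_res; rewrite /fusion_expansion.
apply: epsilon_spec; pose supp := [fset x.2 | x in s]%fset.
pose c : {fsfun n.-tuple nat -> rat with 0} :=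
  [fsfun ka in supp => \sum_(x <- s | x.2 == ka) x.1].
exists c.
have c_sub : {subset finsupp c <= supp}.
  by move=> ka; rewrite mem_finsupp fsfunE; case: ifP => //; rewrite eqxx.
split.
  by move=> ka /c_sub /imfsetP[x /= /s_res x_res ->].
suff -> : \sum_(ka <- finsupp c) c ka *: schur ka
    = \sum_(x <- s) x.1 *: schur x.2 by [].
rewrite (big_fset_incl _ (B := supp)); first last.
- by move=> ka _ /fsfun_dflt->; rewrite scale0r.
- exact/fsubsetP.
transitivity (\sum_(ka <- supp) \sum_(x <- s | x.2 == ka) x.1 *: schur x.2).
  rewrite big_seq [RHS]big_seq; apply: eq_bigr => ka ka_supp.
  rewrite fsfunE ka_supp scaler_suml; apply: eq_bigr => x /eqP-> //.
rewrite (exchange_big_dep predT) //= [LHS]big_seq [RHS]big_seq.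
apply: eq_bigr => x x_s; rewrite big_mkcond /=.
have x_supp : x.2 \in supp by apply: in_imfset.
rewrite (big_fsetD1 x.2) //= eqxx big1_fset ?addr0 // => ka.
by rewrite in_fsetD1 eq_sym => /andP[/negPf-> _].
Qed.

End FusionCoordinates.

(** * The Pieri rule and Schur polynomials with two columns *)

Section VerticalStrips.
Variable n : nat.
Implicit Types (la mu nu : n.-tuple nat) (S T : {set 'I_n}).

Definition add_strip la S : n.-tuple nat :=
  [tuple (tnth la i + (i \in S))%N | i < n].

Lemma nth_strip la S (i : 'I_n) :
  nth 0%N (add_strip la S) i = (nth 0%N la i + (i \in S))%N.
Proof. by rewrite -!tnth_nth tnth_mktuple. Qed.

Lemma is_partitionP la :
  reflect (forall i j : 'I_n, (i <= j)%N -> (nth 0%N la j <= nth 0%N la i)%N)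
          (is_partition la).
Proof.
apply: (iffP idP) => [la_part i j|decr]; first exact: partition_nth.
apply/(sortedP 0%N) => i; rewrite size_tuple => lt_i.
exact: (decr (Ordinal (ltnW lt_i)) (Ordinal lt_i) (leqnSn i)).
Qed.

Lemma shifted_strip la S :
  shifted (add_strip la S) = (shifted la + mesym1 S)%MM.
Proof. by apply/mnmP => i; rewrite mnmDE !mnmE !tnth_mktuple addnAC. Qed.

(** An ascent created by adding at most one box to each row has height one, so
    after the shift by the staircase two neighbouring exponents coincide. *)
Lemma alternant_strip_eq0 la S :
    is_partition la -> ~~ is_partition (add_strip la S) ->
  alternant (shifted (add_strip la S)) = 0.
Proof.
move=> la_part; pose ascent (i : 'I_n) := [exists j : 'I_n, (j == i.+1 :> nat)
  && (nth 0 (add_strip la S) i < nth 0 (add_strip la S) j)%N].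
case: (pickP ascent).
  move=> i /existsP[j /andP[/eqP def_j]]; rewrite !nth_strip => lt_ij _.
  apply: (@alternant_eq0 _ _ i j).
    by apply/eqP => eq_ij; move: def_j; rewrite eq_ij => /n_Sn.
  rewrite !shiftedE !nth_strip def_j.
  have := @partition_nth _ la i j la_part; rewrite def_j => /(_ (leqnSn _)).
  move: lt_ij; rewrite def_j; have := ltn_ord j; rewrite def_j.
  by case: (i \in S); case: (j \in S) => /=; lia.
move=> no_ascent /negP[]; apply/(sortedP 0%N) => i; rewrite size_tuple => lt_i.
have /negbT := no_ascent (Ordinal (ltnW lt_i)); rewrite negb_exists.
by move=> /forallP /(_ (Ordinal lt_i)); rewrite /= eqxx /= -leqNgt.
Qed.

(** After multiplication by the denominator the rule expands an alternant; the
    strips that leave the partitions contribute vanishing alternants. *)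
Lemma pieri la r :
    is_partition la ->
  mesym n rat r * schur la
    = \sum_(S : {set 'I_n} | (#|S| == r) && is_partition (add_strip la S))
        schur (add_strip la S).
Proof.
move=> la_part; apply: (mulIf (alternant_rho_neq0 n)).
rewrite -mulrA schur_alternant [RHS]mulr_suml.
rewrite (mulr_alternant_sum _ (mesymE n rat r)) ?mesym_sym //.
rewrite (bigID (fun S => is_partition (add_strip la S))) /= addrC big1 ?add0r.
  by apply: eq_bigr => S _; rewrite schur_alternant shifted_strip.
by move=> S /andP[_ not_part]; rewrite -shifted_strip alternant_strip_eq0.
Qed.

(** The partition $(2^q, 1^{p-q})$ when $q \le p \le n$. *)
Definition columns p q : n.-tuple nat :=
  [tuple ((i < p)%N + (i < q)%N)%N | i < n].

Lemma nth_columns p q (i : 'I_n) :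
  nth 0%N (columns p q) i = ((i < p) + (i < q))%N.
Proof. by rewrite -tnth_nth tnth_mktuple. Qed.

Lemma columns_partition p q : is_partition (columns p q).
Proof. apply/is_partitionP => i j; rewrite !nth_columns; lia. Qed.

Definition initial c : {set 'I_n} := [set i : 'I_n | (i < c)%N].

Lemma card_initial c : (c <= n)%N -> #|initial c| = c.
Proof.
move=> le_cn; have widen_inj : injective (widen_ord le_cn).
  by move=> i j [] /val_inj.
rewrite -[RHS]card_ord -(card_imset _ widen_inj).
apply/eq_card => i; rewrite inE; apply/idP/imsetP => [lt_i|[j _ ->]].
  by exists (Ordinal lt_i); rewrite ?inE //; apply/val_inj.
by rewrite /= ltn_ord.
Qed.

Lemma initialP T :
  (forall i j : 'I_n, (i <= j)%N -> j \in T -> i \in T) -> T = initial #|T|.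
Proof.
move=> T_init; apply/eqP.
rewrite eqEcard card_initial ?leqnn ?andbT; last first.
  by rewrite -[X in (_ <= X)%N]card_ord max_card.
apply/subsetP => j j_T; rewrite inE ltnNge; apply/negP => le_Tj.
suff: (#|initial j.+1| <= #|T|)%N.
  by rewrite card_initial ?ltn_ord // ltnNge le_Tj.
by apply/subset_leq_card/subsetP => i; rewrite inE ltnS => /T_init ->.
Qed.

(** The column $(1^p)$ is constant on the rows above row $p$, and again from
    row $p$ on; within each part a strip is closed under moving up. *)
Lemma strip_column p T (i j : 'I_n) :
    is_partition (add_strip (columns p 0) T) -> (i <= j)%N ->
    (i < p)%N = (j < p)%N -> j \in T -> i \in T.
Proof.
move=> part_T le_ij eq_p j_T; have := partition_nth part_T le_ij.
by rewrite !nth_strip !nth_columns eq_p j_T; case: (i \in T) => //=; lia.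
Qed.

Lemma add_strip_initial p q : add_strip (columns p 0) (initial q) = columns p q.
Proof. by apply: eq_from_tnth => i; rewrite !tnth_mktuple ltn0 inE addn0. Qed.

Lemma schur_columns0 p : (p <= n)%N -> schur (columns p 0) = mesym n rat p.
Proof.
move=> le_pn; have schur0 : schur (columns 0 0) = 1.
  apply: (mulIf (alternant_rho_neq0 n)); rewrite schur_alternant mul1r.
  by apply: eq_alternant => i; rewrite !mnmE tnth_mktuple.
rewrite -[RHS]mulr1 -schur0 pieri ?columns_partition // (big_pred1 (initial p)).
  by congr schur; apply: eq_from_tnth => i; rewrite !tnth_mktuple inE addn0.
move=> T; apply/andP/eqP => [[/eqP card_T part_T]|->].
  rewrite -card_T; apply: initialP => i j le_ij.
  exact: strip_column part_T le_ij _.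
by rewrite add_strip_initial card_initial // columns_partition.
Qed.

(** The strips that do not meet row $p$, the first empty row of the column
    $(1^p)$, lie entirely beside the column. When $p = n$ the condition is
    void. *)
Lemma strip_avoiding p q T :
    (q <= p)%N -> (p <= n)%N ->
  [&& #|T| == q, is_partition (add_strip (columns p 0) T)
    & [forall i in T, i != p :> nat]] = (T == initial q).
Proof.
move=> le_qp le_pn; apply/and3P/eqP => [[/eqP<- part_T /forall_inP notp]|->].
  have lt_p j : j \in T -> (j < p)%N.
    move=> j_T; rewrite ltnNge; apply/negP => le_pj.
    have lt_pn : (p < n)%N by apply: leq_ltn_trans (ltn_ord j).
    suff /notp : Ordinal lt_pn \in T by rewrite eqxx.
    by apply: (strip_column part_T (j := j)) => //=; rewrite ltnn ltnNge le_pj.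
  apply: initialP => i j le_ij j_T; apply: (strip_column part_T le_ij) => //.
  by rewrite (leq_ltn_trans le_ij) ?lt_p.
rewrite add_strip_initial card_initial ?(leq_trans le_qp) //.
rewrite columns_partition eqxx; split=> //.
by apply/forall_inP => i; rewrite inE; lia.
Qed.

(** Expand both products by the Pieri rule. A strip added to $(1^p)$ that
    contains row $p$ becomes, after moving this row into the column, a strip
    added to $(1^{p+1})$; every strip of size less than $p + 1$ added to
    $(1^{p+1})$ arises in this way, as it would have to contain all of rows
    $0, \dots, p$ to contain row $p$. Only the strip that completes the second
    column is left over. *)
Lemma schur_columns p q :
    (q <= p)%N -> (p <= n)%N ->
  schur (columns p q) = mesym n rat p * mesym n rat q
    - (if q is q'.+1 then mesym n rat p.+1 * mesym n rat q' else 0).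
Proof.
move=> le_qp le_pn; case: q le_qp => [|q] le_qp.
  by rewrite mesym0E mulr1 subr0 schur_columns0.
pose avoids T := [forall i in T, (i : 'I_n) != p :> nat].
rewrite [mesym n rat p * _]mulrC -(schur_columns0 le_pn).
rewrite (pieri _ (columns_partition _ _)).
rewrite (bigID avoids) /= (big_pred1 (initial q.+1)) => [|T]; last first.
  by rewrite -andbA strip_avoiding.
rewrite add_strip_initial -[LHS]addr0 -addrA; congr (_ + _).
apply/esym/eqP; rewrite subr_eq0; apply/eqP.
have [lt_pn|ge_pn] := ltnP p n; last first.
  rewrite mesym_geqnE // mul0r big1 // => T /andP[_ /forall_inPn[i _]].
  by rewrite negbK => /eqP def_i; have := ltn_ord i; rewrite def_i ltnNge ge_pn.
have -> : mesym n rat p.+1 * mesym n rat q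
    = mesym n rat q * schur (columns p.+1 0).
  by rewrite schur_columns0 // mulrC.
rewrite (pieri _ (columns_partition _ _)).
pose P := Ordinal lt_pn.
have avoidsE T : avoids T = (P \notin T).
  apply/forall_inP/idP => [T_p|P_T i i_T].
    by apply/negP => /T_p; rewrite eqxx.
  by apply: contra P_T => /eqP eq_i; rewrite (_ : P = i) //; apply/val_inj.
have strip_add T : P \notin T ->
    add_strip (columns p 0) (P |: T) = add_strip (columns p.+1 0) T.
  move=> P_T; apply: eq_from_tnth => i.
  rewrite !tnth_mktuple !ltn0 !addn0 in_setU1.
  have [->|neq_i] := eqVneq i P; first by rewrite (negPf P_T) ltnn ltnSn.
  rewrite ltnS [(i <= p)%N]leq_eqVlt -[i == p :> nat]/(val i == val P).
  by rewrite val_eqE (negPf neq_i).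
rewrite [LHS](reindex_onto (fun T => P |: T) (fun T => T :\ P)); last first.
  by move=> T; rewrite avoidsE negbK => /andP[_ P_T]; rewrite setD1K.
apply: eq_big => [T|T]; last first.
  rewrite avoidsE => /andP[_ /eqP def_T].
  by rewrite strip_add // -def_T !inE eqxx.
have [P_T|P_T] := boolP (P \in T); last first.
  rewrite avoidsE setU1K // eqxx andbT cardsU1 P_T eqSS strip_add //.
  by rewrite setU11 andbT.
rewrite avoidsE; apply/andP/andP => [[_ /eqP def_T]|[/eqP card_T part_T]].
  by move: P_T; rewrite -def_T !inE eqxx.
suff: (#|initial p.+1| <= #|T|)%N by rewrite card_initial // card_T; lia.
apply/subset_leq_card/subsetP => i; rewrite inE => le_ip.
by apply: (strip_column part_T (j := P)) => //; rewrite ltnSn.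
Qed.

End VerticalStrips.

(** * The Pieri rule in the quotient *)

Section FusionPieri.
Variables n k : nat.
Hypothesis n_gt0 : (0 < n)%N.
Implicit Types (la mu nu : n.-tuple nat) (S T : {set 'I_n}).

Lemma width_ends :
  exists i j : 'I_n, [/\ i = 0 :> nat, j = n.-1 :> nat &
    forall la, width la = (nth 0 la i - nth 0 la j)%N].
Proof.
have lt_n : (n.-1 < n)%N by rewrite prednK.
by exists (Ordinal n_gt0), (Ordinal lt_n).
Qed.

Lemma width_strip la S :
  is_partition la -> (width (add_strip la S) <= (width la).+1)%N.
Proof.
move=> la_part; have [i [j [_ _ widthE]]] := width_ends.
by rewrite !widthE !nth_strip; case: (i \in S); case: (j \in S) => /=; lia.
Qed.

(** A strip changes the width by at most one, so a partition that is lost has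
    width $k + 1$ and its Schur polynomial is a generator of the ideal. *)
Lemma fusion_pieri la r :
    la \in restricted k ->
  fusion_ideal k (mesym n rat r * schur la
    - \sum_(S : {set 'I_n} | (#|S| == r) && (add_strip la S \in restricted k))
        schur (add_strip la S)).
Proof.
move=> /andP[la_part la_width]; rewrite pieri //.
rewrite (bigID (fun S => add_strip la S \in restricted k)) /= [X in X - _]addrC.
have strip_res S : (#|S| == r) && is_partition (add_strip la S)
    && (add_strip la S \in restricted k)
  = (#|S| == r) && (add_strip la S \in restricted k).
  by rewrite !inE; case: is_partition; rewrite ?andbF ?andbT.
rewrite (eq_bigl _ _ strip_res) addrK; apply: big_ind => [||S].
- exact: fusion_ideal0.
- exact: fusion_idealD.
rewrite inE => /andP[/andP[_ S_part]]; rewrite S_part -ltnNge => S_width.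
apply: fusion_ideal_schur => //; apply/eqP; rewrite eqn_leq S_width andbT.
by apply: leq_trans (width_strip _ la_part) _.
Qed.

(** Together with [schur_columns] this provides the expansions of the products
    considered, without straightening arbitrary Schur polynomials. *)
Lemma restricted_span_mesym r p :
  restricted_span k p -> restricted_span k (mesym n rat r * p).
Proof.
move=> [s [/allP s_res s_ideal]].
have span_sub (f g : {mpoly rat[n]}) :
    restricted_span k g -> fusion_ideal k (f - g) -> restricted_span k f.
  move=> g_span /restricted_span_ideal fg_span.
  by rewrite -[f](subrK g); apply: restricted_spanD.
apply: (span_sub _ (mesym n rat r * \sum_(x <- s) x.1 *: schur x.2)).
  rewrite mulr_sumr big_seq; apply: restricted_span_sum => x /s_res x_res.
  rewrite -scalerAr; apply: restricted_spanZ.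
  apply: span_sub (fusion_pieri r x_res).
  by apply: restricted_span_sum => S /andP[_]; apply: restricted_span_schur.
by rewrite -mulrBr; apply: fusion_idealM s_ideal; apply: mesym_sym.
Qed.

Lemma fusion_coord_pieri nu r la f :
    f \is symmetric -> la \in restricted k ->
  fusion_coord k nu (f * (mesym n rat r * schur la))
    = \sum_(S : {set 'I_n} | (#|S| == r) && (add_strip la S \in restricted k))
        fusion_coord k nu (f * schur (add_strip la S)).
Proof.
move=> f_sym la_res; rewrite -raddf_sum -mulr_sumr /=.
apply/eqP; rewrite -subr_eq0 -raddfB -mulrBr /=; apply/eqP.
apply: (fusion_coord_ideal n_gt0); apply: fusion_idealM => //.
exact: fusion_pieri.
Qed.

Definition strip_pairs p q la nu : {set {set 'I_n} * {set 'I_n}} :=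
  [set ST : {set 'I_n} * {set 'I_n} |
     [&& #|ST.1| == p, #|ST.2| == q, add_strip la ST.1 \in restricted k
       & add_strip (add_strip la ST.1) ST.2 == nu]].

Lemma fusion_coord_mesym2 nu p q la :
    la \in restricted k -> nu \in restricted k ->
  fusion_coord k nu (mesym n rat q * (mesym n rat p * schur la))
    = #|strip_pairs p q la nu|%:R.
Proof.
move=> la_res nu_res; rewrite fusion_coord_pieri ?mesym_sym //.
rewrite (eq_bigr (fun S => \sum_(T : {set 'I_n} | #|T| == q)
    (add_strip (add_strip la S) T == nu)%:R)) => [|S /andP[_ S_res]].
  rewrite pair_big_dep -sum1_card natr_sum big_mkcond [RHS]big_mkcond /=.
  apply: eq_bigr => -[S T] _; rewrite in_set /=.
  case: (#|S| == p) => //=; case: (add_strip la S \in _); rewrite ?andbF //=.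
  by case: (#|T| == q) => //=; case: (_ == nu).
rewrite -[mesym n rat q * _]mul1r fusion_coord_pieri ?rpred1 //.
rewrite [RHS](bigID (fun T =>
  add_strip (add_strip la S) T \in restricted k)) /=.
rewrite [X in _ + X]big1 ?addr0 => [|T /andP[_]].
  by apply: eq_bigr => T /andP[_ T_res]; rewrite mul1r fusion_coord_schur.
by case: eqP => // ->; rewrite nu_res.
Qed.

End FusionPieri.

Section Counting.
Variables n : nat.
Hypothesis n_gt0 : (0 < n)%N.
Implicit Types (la mu nu : n.-tuple nat) (S T : {set 'I_n}).

Lemma columnsP mu :
    is_partition mu -> (nth 0%N mu 0 <= 2)%N ->
  exists p q, [/\ (q <= p)%N, (p <= n)%N & mu = columns n p q].
Proof.
move=> mu_part mu_le2.
pose cond c := [set i : 'I_n | (c <= nth 0 mu i)%N].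
have cond_init c : cond c = initial n #|cond c|.
  apply: initialP => i j le_ij; rewrite !inE => /leq_trans; apply.
  exact: partition_nth.
exists #|cond 1%N|, #|cond 2|; split.
- by apply/subset_leq_card/subsetP => i; rewrite !inE; apply: ltnW.
- by rewrite -[X in (_ <= X)%N]card_ord max_card.
apply: eq_from_tnth => i; rewrite tnth_mktuple (tnth_nth 0%N).
have le_2 : (nth 0 mu i <= 2)%N.
  by apply: leq_trans mu_le2; apply: partition_nth.
have mem_cond c : (i < #|cond c|)%N = (c <= nth 0 mu i)%N.
  by have /setP/(_ i) := cond_init c; rewrite !inE => ->.
rewrite !mem_cond; move: le_2.
by case: (nth 0 mu i) => [|[|[|]]].
Qed.

Lemma fusion_coef_columns k la nu p q :
    la \in restricted k -> nu \in restricted k -> (q <= p)%N -> (p <= n)%N ->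
  fusion_coef k la (columns n p q) nu
    = #|strip_pairs k p q la nu|%:R
      - (if q is q'.+1 then #|strip_pairs k p.+1 q' la nu|%:R else 0).
Proof.
move=> la_res nu_res le_qp le_pn.
have e2_span r s :
    restricted_span k (mesym n rat s * (mesym n rat r * schur la)).
  by do 2!apply: restricted_span_mesym => //; apply: restricted_span_schur.
have def_prod : schur la * schur (columns n p q)
  = mesym n rat q * (mesym n rat p * schur la)
    - (if q is q'.+1 then mesym n rat q' * (mesym n rat p.+1 * schur la)
       else 0).
  rewrite mulrC schur_columns // mulrBl; congr (_ - _).
    by rewrite [_ * mesym n rat q]mulrC mulrA.
  by case: (q) => [|q']; rewrite ?mul0r // [mesym n rat p.+1 * _]mulrC mulrA.
rewrite fusion_coef_coord ?def_prod //; last first.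
  rewrite -scaleN1r; apply: restricted_spanD => //; apply: restricted_spanZ.
  case: (q) => // ; exact/restricted_span_ideal/fusion_ideal0.
rewrite raddfB /= fusion_coord_mesym2 //; congr (_ - _).
by case: (q) => [|q']; rewrite ?raddf0 // fusion_coord_mesym2.
Qed.

End Counting.

(** * Transferring a step of a lattice path *)

Section Injection.
Variable n : nat.
Implicit Types (S T : {set 'I_n}) (ST : {set 'I_n} * {set 'I_n}).

(** The path read from the top row: up at the rows of the first set, down at
    those of the second, level where both or neither apply. *)
Definition height ST (j : nat) : int :=
  \sum_(l < n | (l < j)%N) ((l \in ST.1 : nat)%:Z - (l \in ST.2 : nat)%:Z).

Lemma height0 ST : height ST 0 = 0.
Proof. exact: big_pred0_eq. Qed.

Lemma height_step ST (i : 'I_n) :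
  height ST i.+1 = height ST i + (i \in ST.1 : nat)%:Z - (i \in ST.2 : nat)%:Z.
Proof.
rewrite /height (bigD1 i) //= addrC addrA; congr (_ + _ - _).
by apply: eq_bigl => l; rewrite ltnS andbC [RHS]ltn_neqAle.
Qed.

Lemma height_end ST : height ST n = #|ST.1|%:Z - #|ST.2|%:Z.
Proof.
have sum_mem S : \sum_(l < n) (l \in S : nat)%:Z = #|S|%:Z.
  rewrite -(big_morph Posz PoszD (erefl 0)) -sum1_card; congr Posz.
  by rewrite [RHS]big_mkcond; apply: eq_bigr => l _; case: (l \in S).
rewrite -!sum_mem -sumrB; apply: eq_bigl => l; exact: ltn_ord.
Qed.

(** The step that reaches the maximum of the path for the first time. *)
Definition pivot ST : pred 'I_n := fun i =>
  [forall j : 'I_n.+1, (height ST j <= height ST i.+1)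
     && ((j <= i)%N ==> (height ST j < height ST i.+1))].

Lemma pivotP ST (i : 'I_n) :
  reflect ((forall j, (j <= n)%N -> height ST j <= height ST i.+1)
           /\ (forall j, (j <= i)%N -> height ST j < height ST i.+1))
          (pivot ST i).
Proof.
apply: (iffP forallP) => [piv|[le_i lt_i] j].
  split=> j le_j.
    by have /andP[] := piv (Ordinal (le_j : j < n.+1)%N).
  have lt_j : (j < n.+1)%N by rewrite (leq_ltn_trans le_j) // ltnS ltnW.
  by have /andP[_ /implyP] := piv (Ordinal lt_j); apply.
have le_j : (j <= n)%N by rewrite -ltnS.
by rewrite le_i //=; apply/implyP; apply: lt_i.
Qed.

(** A path that ends above its start does not have its first maximum there, so
    a step leads to it. *)
Lemma exists_pivot ST : 0 < height ST n -> exists i, pivot ST i.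
Proof.
move=> gt0; pose top j :=
  (j <= n)%N && [forall l : 'I_n.+1, height ST l <= height ST j].
have ex_top : exists j, top j.
  have true0 : predT (ord0 : 'I_n.+1) by [].
  case: (Order.TotalTheory.arg_maxP (fun l : 'I_n.+1 => height ST l) true0).
  move=> j _ max_j; exists j; rewrite /top -ltnS ltn_ord /=.
  by apply/forallP => l; apply: max_j.
case: (ex_minnP ex_top) => -[|i] /andP[le_i /forallP top_i] min_i.
  by have := top_i ord_max; rewrite height0 leNgt gt0.
exists (Ordinal le_i); apply/pivotP; split=> j le_j.
  exact: (top_i (Ordinal (le_j : j < n.+1)%N)).
have lt_j : (j < n.+1)%N by rewrite (leq_ltn_trans le_j) // ltnW.
rewrite ltNge; apply/negP => le_ij.
suff /min_i : top j by rewrite ltnNge le_j.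
rewrite /top -ltnS lt_j /=; apply/forallP => l.
exact: le_trans (top_i l) le_ij.
Qed.

Lemma pivot_mem ST i : pivot ST i -> (i \in ST.1) /\ (i \notin ST.2).
Proof.
move=> /pivotP[_ /(_ i (leqnn i))]; rewrite height_step.
by case: (i \in ST.1); case: (i \in ST.2) => //=; lia.
Qed.

Definition transfer ST i := (ST.1 :\ i, i |: ST.2).

Lemma height_transfer ST i j : i \in ST.1 -> i \notin ST.2 ->
  height (transfer ST i) j = height ST j - (if (i < j)%N then 2 else 0).
Proof.
move=> i_S i_T; rewrite /height.
have other l : l != i ->
    (l \in (transfer ST i).1 : nat)%:Z - (l \in (transfer ST i).2 : nat)%:Z
      = (l \in ST.1 : nat)%:Z - (l \in ST.2 : nat)%:Z.
  by move=> neq_li; rewrite !inE (negPf neq_li).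
case: ifP => [lt_ij|ge_ij]; last first.
  rewrite subr0; apply: eq_bigr => l lt_lj; apply: other.
  by apply/eqP => eq_li; rewrite -eq_li lt_lj in ge_ij.
rewrite (bigD1 i) //= [in RHS](bigD1 i) //= !inE eqxx i_S (negPf i_T) /=.
rewrite (eq_bigr _ (fun l hl => other l (proj2 (andP hl)))).
by rewrite [RHS]addrAC; congr (_ + _).
Qed.

(** After the transfer the path drops by $2$ beyond the pivot, so the maximum
    is now attained for the last time just before the pivot: this determines
    the pivot, and with it the original pair. *)
Lemma transfer_inj ST1 ST2 i1 i2 : pivot ST1 i1 -> pivot ST2 i2 ->
  transfer ST1 i1 = transfer ST2 i2 -> ST1 = ST2.
Proof.
move=> piv1 piv2 eq_tr.
have last_max ST i (H := height (transfer ST i)) : pivot ST i ->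
    (forall j, (j <= i)%N -> H j <= H i)
      /\ (forall j, (i < j <= n)%N -> H j < H i).
  rewrite {}/H => piv.
  have [i_S i_T] := pivot_mem piv; have /pivotP[le_i lt_i] := piv.
  have step := height_step ST i; rewrite i_S (negPf i_T) /= in step.
  split=> j => [le_j|/andP[lt_j le_j]]; rewrite !height_transfer // ltnn.
    by have := lt_i j le_j; rewrite ltnNge le_j /=; lia.
  by have := le_i j le_j; rewrite lt_j; lia.
have [le1 lt1] := last_max _ _ piv1; have [le2 lt2] := last_max _ _ piv2.
rewrite eq_tr in le1 lt1.
have eq_i : i1 = i2.
  case: (ltngtP i1 i2) => [lt_12|lt_21|/val_inj //].
    have := lt1 i2; rewrite lt_12 ltnW // => /(_ isT).
    by rewrite ltNge le2 // ltnW.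
  have := lt2 i1; rewrite lt_21 ltnW // => /(_ isT).
  by rewrite ltNge le1 // ltnW.
have [i_S1 i_T1] := pivot_mem piv1; have [i_S2 i_T2] := pivot_mem piv2.
case: eq_tr; rewrite eq_i in i_S1 i_T1 * => eqS eqT.
rewrite [ST1]surjective_pairing [ST2]surjective_pairing.
by rewrite -(setD1K i_S1) eqS setD1K // -(setU1K i_T1) eqT setU1K.
Qed.

End Injection.

(** * Monotonicity in the level *)

Section WallPairs.
Variables n k : nat.
Hypothesis n_gt0 : (0 < n)%N.
Variables la nu : n.-tuple nat.
Hypotheses (la_res : la \in restricted k) (nu_res : nu \in restricted k).
Implicit Types (S T : {set 'I_n}) (ST : {set 'I_n} * {set 'I_n}).

Definition wall_pairs p q :=
  strip_pairs k.+1 p q la nu :\: strip_pairs k p q la nu.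

Lemma wall_pairsP p q ST :
  reflect [/\ #|ST.1| = p, #|ST.2| = q, is_partition (add_strip la ST.1),
              width (add_strip la ST.1) = k.+1
            & add_strip (add_strip la ST.1) ST.2 = nu]
          (ST \in wall_pairs p q).
Proof.
rewrite !inE; apply: (iffP idP).
  case/andP=> notk /and4P[/eqP card_S /eqP card_T /andP[S_part le_k] eq_nu].
  split=> //; last exact/eqP.
  apply/eqP; rewrite eqn_leq le_k ltnNge; apply: contra notk => le_k'.
  by rewrite card_S card_T S_part le_k' eq_nu !eqxx.
by case=> -> -> -> -> ->; rewrite !eqxx ltnn leqnn.
Qed.

Lemma card_strip_pairsS p q :
  #|strip_pairs k.+1 p q la nu|
    = (#|strip_pairs k p q la nu| + #|wall_pairs p q|)%N.
Proof.
rewrite /wall_pairs cardsD (setIidPr _) ?subnKC ?subset_leq_card //.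
all: apply/subsetP => ST; rewrite !inE => /and4P[-> -> /andP[-> le_k] ->].
all: by rewrite (leq_trans le_k).
Qed.

(** Since $\lambda$ has width at most $k$, the width can grow to $k + 1$ only
    if the last row receives no box. *)
Lemma wall_pair_ends p q ST (i : 'I_n) : ST \in wall_pairs p q ->
  i \in ST.1 -> i != n.-1 :> nat.
Proof.
move=> /wall_pairsP[_ _ _ S_width _] i_S; apply/eqP => def_i.
have [i0 [i1 [_ def_i1 widthE]]] := width_ends n_gt0.
have eq_i : i = i1 by apply/val_inj; rewrite /= def_i.
move: S_width la_res; rewrite inE !widthE !nth_strip -eq_i i_S => + /andP[_].
by case: (i0 \in ST.1) => /=; lia.
Qed.

(** The pivot is not the first row, since the final height is at least $2$ and
    a single step reaches height at most $1$. Rows $i$ and $i + 1$ of the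
    middle partition can be out of order after the transfer only if they had
    equal length and row $i + 1$ received a box in the first strip; as row $i$
    of $\nu$ gets no box in the second strip, neither does row $i + 1$, so the
    step at row $i + 1$ goes up, against the maximality of the height at the
    pivot. *)
Lemma transfer_wall_pair p q ST i :
    (q < p)%N -> ST \in wall_pairs p.+1 q -> pivot ST i ->
  transfer ST i \in wall_pairs p q.+1.
Proof.
move=> lt_qp ST_wall piv; have [i_S i_T] := pivot_mem piv.
have /pivotP[max_i _] := piv.
have i_last := wall_pair_ends ST_wall i_S.
have /wall_pairsP[card_S card_T S_part S_width def_nu] := ST_wall.
have i_first : i != 0%N :> nat.
  apply/eqP => i0; have := max_i n (leqnn n); rewrite height_end height_step i0.
  rewrite height0 card_S card_T i_S (negPf i_T) /=; lia.
have strip_tr (j : 'I_n) : nth 0%N (add_strip la ST.1) j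
    = (nth 0 (add_strip la (ST.1 :\ i)) j + (j == i))%N.
  by rewrite !nth_strip !inE -addnA; case: eqP => [->|]; rewrite ?i_S //= addn0.
apply/wall_pairsP; split=> /=.
- by move: card_S; rewrite (cardsD1 i) i_S => -[].
- by rewrite cardsU1 i_T card_T.
- apply/(sortedP 0%N) => l; rewrite size_tuple /= => lt_l.
  pose j := Ordinal (ltnW lt_l); pose j' := Ordinal lt_l.
  have eq_j := strip_tr j; have eq_j' := strip_tr j'; rewrite /= in eq_j eq_j'.
  have [eq_ji|neq_ji] := eqVneq j i; last first.
    rewrite (negPf neq_ji) addn0 in eq_j; rewrite -eq_j.
    apply: leq_trans (partition_nth S_part (leqnSn l)).
    by rewrite eq_j' leq_addr.
  rewrite -{i}eq_ji in i_S i_T max_i strip_tr i_first i_last eq_j eq_j' piv *.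
  have nu_part : is_partition nu by case/andP: nu_res.
  have la_part : is_partition la by case/andP: la_res.
  have le_la : (nth 0 la j' <= nth 0 la j)%N by apply: partition_nth.
  have := partition_nth nu_part (leqnSn l : j <= j')%N.
  rewrite -{1 2}def_nu !nth_strip i_S (negPf i_T) addn0 => le_nu.
  rewrite -[l.+1]/(val j') -[l]/(val j) !nth_strip !inE eqxx i_S addn0.
  have -> : (j' == j) = false by rewrite -val_eqE /= eqn_leq ltnn.
  have := max_i l.+2 lt_l; rewrite -[l.+1]/(val j') height_step => le_height.
  case: (j' \in ST.1) le_height le_nu => /=; last by rewrite addn0.
  case: (j' \in ST.2) => /= [_|]; first by rewrite leq_add2r.
  by rewrite subr0 gerDl.
- have [i0 [i1 [def_i0 def_i1 widthE]]] := width_ends n_gt0.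
  rewrite -S_width !widthE !strip_tr.
  have -> : (i0 == i) = false.
    by apply/eqP => eq_i; rewrite -eq_i def_i0 in i_first.
  have -> : (i1 == i) = false.
    by apply/eqP => eq_i; rewrite -eq_i def_i1 eqxx in i_last.
  by rewrite !addn0.
- rewrite -def_nu; apply: eq_from_tnth => j; rewrite !tnth_mktuple !inE.
  by case: eqP => [->|] //=; rewrite i_S (negPf i_T); lia.
Qed.

Lemma card_wall_pairs p q :
  (q < p)%N -> (#|wall_pairs p.+1 q| <= #|wall_pairs p q.+1|)%N.
Proof.
move=> lt_qp; pose f ST :=
  if [pick i | pivot ST i] is Some i then transfer ST i else ST.
have fP ST : ST \in wall_pairs p.+1 q ->
    exists2 i, pivot ST i & f ST = transfer ST i.
  move=> /wall_pairsP[card_S card_T _ _ _]; rewrite /f.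
  case: pickP => [i piv|no_piv]; first by exists i.
  have [|i] := @exists_pivot _ ST; last by rewrite no_piv.
  by rewrite height_end card_S card_T; lia.
rewrite -(card_in_imset (f := f)) => [|ST1 ST2 /fP[i1 piv1 ->] /fP[i2 piv2 ->]].
  apply/subset_leq_card/subsetP => _ /imsetP[ST ST_wall ->].
  by have [i piv ->] := fP _ ST_wall; apply: transfer_wall_pair piv.
exact: transfer_inj.
Qed.

End WallPairs.

Theorem theorem15 (n k : nat) (n_gt0 : (0 < n)%N) (k_gt0 : (0 < k)%N)
  (la mu nu : n.-tuple nat)
  (la_restricted : la \in restricted k)
  (mu_restricted : mu \in restricted k)
  (nu_restricted : nu \in restricted k)
  (mu_columns : nth 0%N mu 0 = 1%N \/ nth 0%N mu 0 = 2%N) :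
  (fusion_coef k la mu nu <= fusion_coef k.+1 la mu nu)%R.
Proof.
have restrictedS ka : ka \in restricted k -> ka \in restricted k.+1.
  by rewrite !inE => /andP[-> /leqW].
have mu_part : is_partition mu by case/andP: mu_restricted.
have mu_le2 : (nth 0 mu 0 <= 2)%N by case: mu_columns => ->.
have [p [q [le_qp le_pn ->]]] := columnsP mu_part mu_le2.
rewrite !fusion_coef_columns ?restrictedS // card_strip_pairsS //.
case: q le_qp => [_|q lt_qp].
  by rewrite !subr0 ler_nat leq_addr.
rewrite card_strip_pairsS // !natrD opprD addrACA lerDl subr_ge0 ler_nat.
exact: card_wall_pairs.
Qed.
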